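(* Let $p$ and $q$ be real numbers with $0<q<p$. Then for every choice of initial values $x_{-1}>0$, $x_0>0$, the sequence $\{x_n\}_{n\ge -1}$ defined by the difference equation $$x_{n+1}=\frac{p+q\,x_n}{1+x_{n-1}},\qquad n=0,1,2,\ldots,$$ converges to the positive equilibrium $$\overline{x}=\frac12\left(q-1+\sqrt{(q-1)^2+4p}\right).$$
   Context: An equilibrium of the difference equation is a number $\overline{x}$ such that the constant sequence $x_n=\overline{x}$ is a solution, i.e. $\overline{x}=\frac{p+q\overline{x}}{1+\overline{x}}$; the number $\overline{x}$ given in the claim is the unique positive equilibrium. *)

(* Defs.v *)
From Stdlib Require Import Reals.
From Coquelicot Require Import Coquelicot.
Open Scope R_scope.

(* Sequences are indexed from -1: [x k] stands for x_{k-1}, so the initial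
   values x_{-1} and x_0 are [x 0%nat] and [x 1%nat].  For positive p, q and
   positive initial values every denominator is positive, so the totality of
   division plays no role. *)
Definition is_solution (p q : R) (x : nat -> R) : Prop :=
  forall n : nat, x (S (S n)) = (p + q * x (S n)) / (1 + x n).

Definition is_equilibrium (p q : R) (y : R) : Prop :=
  is_solution p q (fun _ => y).

Definition xbar (p q : R) : R :=
  1 / 2 * (q - 1 + sqrt ((q - 1) ^ 2 + 4 * p)).

(* Main.v *)
Require Import Defs.
From Stdlib Require Import Reals Lra Psatz.
From Coquelicot Require Import Coquelicot.
Open Scope R_scope.

(** The equation is a dissipative perturbation of Lyness' equation, and the
    Lyness invariant is a global Lyapunov function for it.  Centre the variable
    by [u = x + 1/2].  Then [x_{n+1} (1 + x_{n-1}) = p + q x_n] becomes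

      [u_{n+1} u_{n-1} = a + q u_n - (u_{n+1} - u_{n-1}) / 2],
      [a = p - q/2 + 1/4],

    where [a > 0] because [q < p].  Without the last term this is Lyness'
    equation, with invariant [(1 + q/u) (1 + q/w) (a/q + u + w)].  The shift by
    exactly one half makes the perturbation a multiple of [u_{n+1} - u_{n-1}],
    and so turns the increment of the invariant into minus a square
    ([lyness_decrease]).

    Hence the invariant decreases along every positive solution.  It dominates
    [u], so the solution is bounded; it converges, so its increments vanish, and
    with them [x_{n+2} - x_n].  The orbit is thus asymptotically of period two.
    Two consecutive instances of the equation rule out a genuine two-cycle
    ([consecutive_difference_tends_to_0]), and what remains is that the quadratic
    polynomial of the equilibrium tends to zero along the orbit; its other root
    is negative, so the orbit tends to [xbar]. *)

(** * Equilibria *)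

Lemma is_equilibrium_quadratic (p q y : R) :
  0 < y -> is_equilibrium p q y <-> y * y + (1 - q) * y - p = 0.
Proof.
  intros hy; split.
  - intros H. specialize (H 0%nat); simpl in H.
    assert (E : y * (1 + y) = p + q * y) by (rewrite H at 1; field; lra).
    lra.
  - intros H n. apply (Rmult_eq_reg_r (1 + y)); [|lra].
    transitivity (p + q * y); [lra | field; lra].
Qed.

Lemma xbar_quadratic (p q : R) :
  0 < p -> xbar p q * xbar p q + (1 - q) * xbar p q - p = 0.
Proof.
  intros hp; unfold xbar.
  assert (Hs : 0 <= (q - 1) ^ 2 + 4 * p) by (pose proof (pow2_ge_0 (q - 1)); lra).
  pose proof (sqrt_sqrt _ Hs). nra.
Qed.

(** The two factors [xbar] and [xbar + 1 - q] have product [p] and a positive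
    sum, the square root of the discriminant; the second is minus the other root
    of the equilibrium quadratic. *)
Lemma xbar_roots_signs (p q : R) :
  0 < p -> 0 < xbar p q /\ 0 < xbar p q + 1 - q.
Proof.
  intros hp. unfold xbar.
  assert (Hs : 0 <= (q - 1) ^ 2 + 4 * p) by (pose proof (pow2_ge_0 (q - 1)); lra).
  pose proof (sqrt_sqrt _ Hs). pose proof (sqrt_pos ((q - 1) ^ 2 + 4 * p)).
  split; nra.
Qed.

Lemma equilibrium_quadratic_factor (p q y : R) :
  0 < p ->
  y * y + (1 - q) * y - p = (y - xbar p q) * (y + (xbar p q + 1 - q)).
Proof.
  intros hp. pose proof (xbar_quadratic p q hp). nra.
Qed.

Lemma xbar_unique_equilibrium (p q : R) :
  0 < p -> unique (fun y : R => 0 < y /\ is_equilibrium p q y) (xbar p q).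
Proof.
  intros hp. destruct (xbar_roots_signs p q hp) as [h1 h2]. split.
  - split; [exact h1|].
    apply is_equilibrium_quadratic; [exact h1 | apply xbar_quadratic; exact hp].
  - intros y [hy Hy]. apply is_equilibrium_quadratic in Hy; [|exact hy].
    rewrite equilibrium_quadratic_factor in Hy by exact hp.
    apply Rmult_integral in Hy. lra.
Qed.

(** * The Lyness invariant as a Lyapunov function *)

Definition lyness (a q u w : R) : R :=
  (1 + q / u) * (1 + q / w) * (a / q + u + w).

(** For fixed [u1], [lyness a q u1 z] is, up to a constant, [1 + q/u1] times
    [z + (a + q u1)/z], so its increment from [u0] to [u2] has the factor
    [u2 u0 - (a + q u1)], which the recurrence makes proportional to [u2 - u0]. *)
Lemma lyness_decrease (a q u0 u1 u2 : R) :
  0 < q -> 0 < u0 -> 0 < u1 -> 0 < u2 ->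
  u2 * u0 = a + q * u1 - (u2 - u0) / 2 ->
  lyness a q u0 u1 - lyness a q u1 u2 =
  (1 + q / u1) * (u2 - u0) ^ 2 / (2 * (u2 * u0)).
Proof.
  intros hq h0 h1 h2 E.
  assert (Ea : a = u2 * u0 - q * u1 + (u2 - u0) / 2) by lra.
  unfold lyness; rewrite Ea; field; lra.
Qed.

Lemma lyness_ge (a q u w : R) :
  0 < a -> 0 < q -> 0 < u -> 0 < w -> u <= lyness a q u w.
Proof.
  intros ha hq hu hw. unfold lyness.
  pose proof (Rdiv_lt_0_compat _ _ hq hu).
  pose proof (Rdiv_lt_0_compat _ _ hq hw).
  pose proof (Rdiv_lt_0_compat _ _ ha hq).
  assert (1 <= (1 + q / u) * (1 + q / w)) by nra.
  nra.
Qed.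

(** * Asymptotic behaviour of positive solutions *)

Lemma solution_pos (p q : R) (x : nat -> R) :
  0 < p -> 0 < q -> 0 < x 0%nat -> 0 < x 1%nat -> is_solution p q x ->
  forall n, 0 < x n.
Proof.
  intros hp hq h0 h1 Hx n.
  enough (H : 0 < x n /\ 0 < x (S n)) by apply H.
  induction n as [|n [IH IH']]; [now split|].
  split; [exact IH'|]. rewrite Hx. apply Rdiv_lt_0_compat; nra.
Qed.

Lemma solution_mult (p q : R) (x : nat -> R) :
  (forall n, 0 < x n) -> is_solution p q x ->
  forall n, x (S (S n)) * (1 + x n) = p + q * x (S n).
Proof.
  intros Hpos Hx n. rewrite Hx. pose proof (Hpos n). field; lra.
Qed.

Lemma is_lim_seq_0_le (u v : nat -> R) :
  (forall n, Rabs (u n) <= v n) -> is_lim_seq v 0 -> is_lim_seq u 0.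
Proof.
  intros H Hv. apply is_lim_seq_abs_0.
  apply (is_lim_seq_le_le (fun _ => 0) _ v); [|apply is_lim_seq_const | exact Hv].
  intros n; split; [apply Rabs_pos | apply H].
Qed.

Lemma is_lim_seq_0_sqr (u : nat -> R) :
  is_lim_seq (fun n => u n ^ 2) 0 -> is_lim_seq u 0.
Proof.
  intros H. apply is_lim_seq_abs_0.
  apply (is_lim_seq_ext (fun n => sqrt (u n ^ 2))).
  { intros n. rewrite <- sqrt_Rsqr_abs. f_equal. unfold Rsqr; ring. }
  rewrite <- sqrt_0.
  apply (is_lim_seq_continuous sqrt); [|exact H].
  apply continuity_pt_sqrt; lra.
Qed.

Lemma is_lim_seq_0_mult_bounded (u v : nat -> R) (K : R) :
  (forall n, Rabs (v n) <= K) -> is_lim_seq u 0 ->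
  is_lim_seq (fun n => u n * v n) 0.
Proof.
  intros Hv Hu. apply (is_lim_seq_0_le _ (fun n => K * Rabs (u n))).
  - intros n. rewrite Rabs_mult, Rmult_comm.
    apply Rmult_le_compat_r; [apply Rabs_pos | apply Hv].
  - replace (Finite 0) with (Rbar_mult K (Finite 0)) by (simpl; f_equal; ring).
    apply is_lim_seq_scal_l. now apply -> is_lim_seq_abs_0.
Qed.

Lemma is_lim_seq_0_mult_ge (u v : nat -> R) (c : R) :
  0 < c -> (forall n, c <= v n) -> is_lim_seq (fun n => u n * v n) 0 ->
  is_lim_seq u 0.
Proof.
  intros hc Hv H.
  apply (is_lim_seq_ext (fun n => u n * v n * / v n)).
  { intros n. pose proof (Hv n). field; lra. }
  apply (is_lim_seq_0_mult_bounded _ _ (/ c)); [|exact H].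
  intros n. pose proof (Hv n).
  rewrite Rabs_pos_eq by (left; apply Rinv_0_lt_compat; lra).
  now apply Rinv_le_contravar.
Qed.

Lemma is_lim_seq_0_minus (u v : nat -> R) :
  is_lim_seq u 0 -> is_lim_seq v 0 -> is_lim_seq (fun n => u n - v n) 0.
Proof.
  intros Hu Hv. replace (Finite 0) with (Finite (0 - 0)) by (f_equal; ring).
  now apply is_lim_seq_minus'.
Qed.

(** The bound is a sublevel set of the Lyapunov function; the limit holds because
    the squares [(x_{n+2} - x_n)^2] are, up to a factor that is bounded on this
    sublevel set, the increments of a convergent sequence. *)
Lemma solution_bounded_and_almost_2_periodic (p q : R) (x : nat -> R) :
  0 < q -> q < p -> (forall n, 0 < x n) -> is_solution p q x ->
  (exists K, forall n, x n <= K) /\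
  is_lim_seq (fun n => x (S (S n)) - x n) 0.
Proof.
  intros hq hqp Hpos Hx.
  pose proof (solution_mult p q x Hpos Hx) as E.
  set (a := p - q / 2 + 1 / 4).
  assert (ha : 0 < a) by (unfold a; lra).
  set (V := fun n => lyness a q (x n + 1 / 2) (x (S n) + 1 / 2)).
  assert (Hdec : forall n,
    V n - V (S n) =
    (1 + q / (x (S n) + 1 / 2)) * (x (S (S n)) - x n) ^ 2 /
    (2 * ((x (S (S n)) + 1 / 2) * (x n + 1 / 2)))).
  { intros n. pose proof (Hpos n). pose proof (Hpos (S n)).
    pose proof (Hpos (S (S n))). pose proof (E n).
    unfold V. rewrite lyness_decrease; unfold a; lra. }
  assert (HV : forall n, x n + 1 / 2 <= V n).
  { intros n. pose proof (Hpos n). pose proof (Hpos (S n)).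
    apply lyness_ge; lra. }
  assert (Hmono : forall n, V (S n) <= V n).
  { intros n. pose proof (Hpos n). pose proof (Hpos (S n)).
    pose proof (Hpos (S (S n))).
    enough (0 <= V n - V (S n)) by lra. rewrite Hdec.
    assert (0 < q / (x (S n) + 1 / 2)) by (apply Rdiv_lt_0_compat; lra).
    apply Rmult_le_pos; [apply Rmult_le_pos; [lra | apply pow2_ge_0]|].
    left; apply Rinv_0_lt_compat; nra. }
  assert (HV0 : forall n, V n <= V 0%nat).
  { induction n as [|n IH]; [lra | pose proof (Hmono n); lra]. }
  set (K := V 0%nat) in *.
  assert (HK : forall n, x n + 1 / 2 <= K).
  { intros n. pose proof (HV n). pose proof (HV0 n). lra. }
  split.
  { exists K. intros n. pose proof (HK n). lra. }
  assert (Hlim : is_lim_seq (fun n => V n - V (S n)) 0).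
  { destruct (ex_finite_lim_seq_decr V 0) as [l Hl].
    - exact Hmono.
    - intros n. pose proof (HV n). pose proof (Hpos n). lra.
    - replace (Finite 0) with (Finite (l - l)) by (f_equal; ring).
      apply is_lim_seq_minus'; [exact Hl|].
      now apply (is_lim_seq_incr_1 V). }
  apply is_lim_seq_0_sqr.
  (* The square is at most [2 K^2] times the drop of [V], since both shifted
     terms in the denominator are at most [K] and [1 + q/u >= 1]. *)
  apply (is_lim_seq_0_le _ (fun n => 2 * K ^ 2 * (V n - V (S n)))).
  - intros n. pose proof (Hpos n). pose proof (Hpos (S n)).
    pose proof (Hpos (S (S n))). pose proof (HK n). pose proof (HK (S (S n))).
    rewrite Rabs_pos_eq by apply pow2_ge_0.
    assert (Hq : 0 < q / (x (S n) + 1 / 2)) by (apply Rdiv_lt_0_compat; lra).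
    set (P := (x (S (S n)) + 1 / 2) * (x n + 1 / 2)).
    assert (HP : 0 < P) by (unfold P; nra).
    assert (HPK : P <= K ^ 2) by (unfold P; nra).
    set (D := (x (S (S n)) - x n) ^ 2).
    assert (HD : 0 <= D) by apply pow2_ge_0.
    assert (HVP : 2 * P * (V n - V (S n)) = (1 + q / (x (S n) + 1 / 2)) * D).
    { rewrite Hdec. fold P D. field. split; lra. }
    pose proof (Hmono n).
    assert (D <= 2 * P * (V n - V (S n))) by (rewrite HVP; nra).
    nra.
  - replace (Finite 0) with (Rbar_mult (2 * K ^ 2) (Finite 0))
      by (simpl; f_equal; ring).
    apply is_lim_seq_scal_l, Hlim.
Qed.

(** Replacing [x_{n+2}] by [x_n] in the equation is asymptotically harmless on a
    bounded orbit. *)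
Lemma almost_2_periodic_relation (p q : R) (x : nat -> R) (K : R) :
  (forall n, 0 < x n) -> (forall n, x n <= K) -> is_solution p q x ->
  is_lim_seq (fun n => x (S (S n)) - x n) 0 ->
  is_lim_seq (fun n => x n * (1 + x n) - p - q * x (S n)) 0.
Proof.
  intros Hpos HK Hx Hd.
  pose proof (solution_mult p q x Hpos Hx) as E.
  apply (is_lim_seq_ext (fun n => (x (S (S n)) - x n) * - (1 + x n))).
  { intros n. pose proof (E n). lra. }
  apply (is_lim_seq_0_mult_bounded _ _ (1 + K)); [|exact Hd].
  intros n. pose proof (Hpos n). pose proof (HK n).
  rewrite Rabs_Ropp, Rabs_pos_eq; lra.
Qed.

(** For a two-cycle [(s, t)], subtracting [s (1 + s) = p + q t] and
    [t (1 + t) = p + q s] gives [(s - t) (1 + s + t + q) = 0], hence [s = t];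
    this is the same computation up to terms that tend to zero. *)
Lemma consecutive_difference_tends_to_0 (p q : R) (x : nat -> R) :
  0 < q -> (forall n, 0 < x n) ->
  is_lim_seq (fun n => x (S (S n)) - x n) 0 ->
  is_lim_seq (fun n => x n * (1 + x n) - p - q * x (S n)) 0 ->
  is_lim_seq (fun n => x n - x (S n)) 0.
Proof.
  intros hq Hpos Hd Hr.
  apply (is_lim_seq_0_mult_ge _ (fun n => 1 + x n + x (S n) + q) 1); [lra | |].
  { intros n. pose proof (Hpos n). pose proof (Hpos (S n)). lra. }
  apply (is_lim_seq_ext (fun n =>
    (x n * (1 + x n) - p - q * x (S n)) -
    (x (S n) * (1 + x (S n)) - p - q * x (S (S n))) -
    (x (S (S n)) - x n) * q)).
  { intros n. ring. }
  apply is_lim_seq_0_minus; [apply is_lim_seq_0_minus|].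
  - exact Hr.
  - exact (proj1 (is_lim_seq_incr_1 _ _) Hr).
  - apply (is_lim_seq_0_mult_bounded _ _ q); [|exact Hd].
    intros _. rewrite Rabs_pos_eq; lra.
Qed.

Theorem mainTheorem1 (p q : R) (hq : 0 < q) (hqp : q < p) :
  unique (fun y : R => 0 < y /\ is_equilibrium p q y) (xbar p q) /\
  (forall x : nat -> R,
     0 < x 0%nat -> 0 < x 1%nat -> is_solution p q x ->
     is_lim_seq x (Finite (xbar p q))).
Proof.
  assert (hp : 0 < p) by lra.
  split; [now apply xbar_unique_equilibrium|].
  intros x h0 h1 Hx.
  pose proof (solution_pos p q x hp hq h0 h1 Hx) as Hpos.
  destruct (solution_bounded_and_almost_2_periodic p q x hq hqp Hpos Hx)
    as [[K HK] Hd].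
  pose proof (almost_2_periodic_relation p q x K Hpos HK Hx Hd) as Hr.
  pose proof (consecutive_difference_tends_to_0 p q x hq Hpos Hd Hr) as Hc.
  destruct (xbar_roots_signs p q hp) as [_ hroot].
  assert (H0 : is_lim_seq (fun n => x n - xbar p q) 0).
  { apply (is_lim_seq_0_mult_ge _ (fun n => x n + (xbar p q + 1 - q))
             (xbar p q + 1 - q)); [exact hroot | |].
    { intros n. pose proof (Hpos n). lra. }
    apply (is_lim_seq_ext (fun n =>
      (x n * (1 + x n) - p - q * x (S n)) - (x n - x (S n)) * q)).
    { intros n. rewrite <- equilibrium_quadratic_factor by exact hp. ring. }
    apply is_lim_seq_0_minus; [exact Hr|].
    apply (is_lim_seq_0_mult_bounded _ _ q); [|exact Hc].
    intros _. rewrite Rabs_pos_eq; lra. }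
  apply (is_lim_seq_ext (fun n => (x n - xbar p q) + xbar p q)).
  { intros n. ring. }
  replace (Finite (xbar p q)) with (Finite (0 + xbar p q)) by (f_equal; ring).
  apply is_lim_seq_plus'; [exact H0 | apply is_lim_seq_const].
Qed.
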